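(* The set $$\Sigma_2=\{r=r_s/2,\ p_t+\Psi=0\}\subset\dot T^*M$$ is an involutive submanifold of $\dot T^*M$ of codimension $2$.
   Context: Fix $r_s,c>0$ and $a=r_s/2$. $M=\mathbb R_t\times(0,\infty)_r\times S^2$ is the extremal Kerr spacetime with Boyer-Lindquist coordinates $(t,r,\theta,\phi)$, where $(\theta,\phi)$ are polar coordinates on $S^2$ (the rotation axis is where $\theta\in\{0,\pi\}$), and $(p_t,p_r,p_\theta,p_\phi)$ are the dual coordinates; the ring singularity is excluded. $\dot T^*M$ is the cotangent bundle minus the zero section, with symplectic form $\sigma=dp_\mu\wedge dq^\mu$. Put $\Sigma=r^2+a^2\cos^2\theta$ and $$\Psi:=\frac{g^{t\phi}}{g^{tt}}p_\phi=\frac{ac}{r^2+a^2+\frac{r_sr}{\Sigma}a^2\sin^2\theta}\,\frac{r_sr}{\Sigma}\,p_\phi,$$ where $g$ is the extremal Kerr metric. $\Psi$ extends to a smooth function on $\dot T^*M$; over the axis $p_\phi=0$ and $\Psi=0$, so there $\Sigma_2$ consists of the covectors with $r=r_s/2$, $p_t=0$. A submanifold $\Lambda\subset T^*M$ is involutive if for every $\lambda\in\Lambda$ the symplectic orthogonal $(T_\lambda\Lambda)^\sigma=\{v\in T_\lambda T^*M:\sigma(v,w)=0\ \forall w\in T_\lambda\Lambda\}$ is contained in $T_\lambda\Lambda$. *)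

(* Defs.v *)
From HB Require Import structures.
From mathcomp Require Import all_boot all_order all_algebra.
From mathcomp Require Import all_classical all_reals all_analysis.
From mathcomp Require Import ring lra.

Set Implicit Arguments.
Unset Strict Implicit.
Unset Printing Implicit Defensive.

Import Order.TTheory GRing.Theory Num.Theory.
Import numFieldNormedType.Exports.

Local Open Scope classical_set_scope.
Local Open Scope ring_scope.

(** * Smooth maps, embedded submanifolds of R^n, tangent vectors *)

(** Only meaningful for open [U], since ['D_v f x] looks at [f] near [x]. *)
Fixpoint Ck (R : realType) (V W : normedModType R) (k : nat) (U : set V)
    (f : V -> W) : Prop :=
  match k with
  | 0 => forall x, U x -> {for x, continuous f}
  | k'.+1 => forall v : V,
      (forall x, U x -> derivable f x v) /\ Ck k' U ('D_v f)
  end.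

Definition smooth_on (R : realType) (V W : normedModType R) (U : set V)
    (f : V -> W) : Prop :=
  forall k, Ck k U f.

Definition diffeo_on (R : realType) (n : nat) (U : set 'rV[R]_n)
    (phi : 'rV[R]_n -> 'rV[R]_n) : Prop :=
  [/\ open U, open (phi @` U), smooth_on U phi &
      exists psi : 'rV[R]_n -> 'rV[R]_n,
        smooth_on (phi @` U) psi /\ (forall x, U x -> psi (phi x) = x)].

(** Slice condition: [phi] maps [S `&` U] onto [phi @` U `&` (R^m x {0})]. *)
Definition flattens (R : realType) (n m : nat) (U : set 'rV[R]_n)
    (phi : 'rV[R]_n -> 'rV[R]_n) (S : set 'rV[R]_n) : Prop :=
  forall x, U x -> (S x <-> forall i : 'I_n, (m <= i)%N -> phi x 0 i = 0).

Definition submanifold (R : realType) (n m : nat) (N : set 'rV[R]_n) : Prop :=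
  (m <= n)%N /\
  forall x, N x -> exists U phi, [/\ U x, diffeo_on U phi & flattens m U phi N].

(** [S] is an embedded submanifold of codimension [k] of the [m]-dimensional
    manifold [N]: around each point of [S], the first [m] components of [phi]
    form a chart of [N] in which [S] is the slice where the last [k] of these
    [m] coordinates vanish. *)
Definition submanifold_of (R : realType) (n m k : nat)
    (N S : set 'rV[R]_n) : Prop :=
  [/\ submanifold m N, (k <= m)%N, S `<=` N &
      forall x, S x -> exists U phi,
        [/\ U x, diffeo_on U phi, flattens m U phi N &
            flattens (m - k) U phi S]].

Definition tangent (R : realType) (n : nat) (S : set 'rV[R]_n) (x : 'rV[R]_n) :
    set 'rV[R]_n :=
  [set v | exists (gamma : R -> 'rV[R]_n) (e : R),
    [/\ 0 < e, smooth_on `]- e, e[%classic gamma,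
        forall s, `]- e, e[%classic s -> S (gamma s),
        gamma 0 = x & 'D_1 gamma 0 = v]].

(** * Cotangent bundles *)

Definition dot (R : realType) (n : nat) (u v : 'rV[R]_n) : R :=
  \sum_(i < n) u 0 i * v 0 i.

Definition base (R : realType) (n : nat) (z : 'rV[R]_(n + n)) : 'rV[R]_n :=
  lsubmx z.
Definition fiber (R : realType) (n : nat) (z : 'rV[R]_(n + n)) : 'rV[R]_n :=
  rsubmx z.

(** A covector on [T_q M], for [M] embedded in R^n, is represented by the unique
    [p] in [T_q M] such that it is [v |-> dot p v].  The one-form [dot p dq] of
    R^(n + n) then restricts to the tautological one-form of [T^*M], and
    [sympl] to the symplectic form of [T^*M]. *)
Definition cotangent (R : realType) (n : nat) (M : set 'rV[R]_n) :
    set 'rV[R]_(n + n) :=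
  [set z | M (base z) /\ tangent M (base z) (fiber z)].

Definition cotangent0 (R : realType) (n : nat) (M : set 'rV[R]_n) :
    set 'rV[R]_(n + n) :=
  cotangent M `&` [set z | fiber z != 0].

(** [sigma = dp_i /\ dq^i]. *)
Definition sympl (R : realType) (n : nat) (v w : 'rV[R]_(n + n)) : R :=
  dot (fiber v) (base w) - dot (fiber w) (base v).

Definition is_involutive (R : realType) (n : nat) (M : set 'rV[R]_n)
    (L : set 'rV[R]_(n + n)) : Prop :=
  forall z, L z ->
    [set v | tangent (cotangent M) z v /\
             forall w, tangent L z w -> sympl v w = 0]
    `<=` tangent L z.

(** * The extremal Kerr spacetime *)

(** R_t x (0, oo)_r x S^2 inside R^5, with coordinates [(t, r, x1, x2, x3)] and
    [(x1, x2, x3) = (sin theta cos phi, sin theta sin phi, cos theta)].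
    The ring singularity [r = 0, theta = pi / 2] is excluded by [0 < r]. *)
Definition spacetime (R : realType) : set 'rV[R]_5 :=
  [set q | 0 < q 0 1 /\ q 0 2 ^+ 2 + q 0 3 ^+ 2 + q 0 4 ^+ 2 = 1].

Section Kerr.
Context {R : realType}.
Variables rs c : R.

Definition spin : R := rs / 2.

(** Below, [ct] stands for [cos theta]. *)
Definition Sigma (r ct : R) : R := r ^+ 2 + spin ^+ 2 * ct ^+ 2.

(** [g^{t phi} / g^{tt}], see [frame_draggingE]. *)
Definition frame_dragging (r ct : R) : R :=
  spin * c / (r ^+ 2 + spin ^+ 2
              + rs * r / Sigma r ct * spin ^+ 2 * (1 - ct ^+ 2))
  * (rs * r / Sigma r ct).

(** The covector applied to [d/dphi = (0, 0, - x2, x1, 0)]. *)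
Definition p_phi (z : 'rV[R]_(5 + 5)) : R :=
  fiber z 0 3 * base z 0 2 - fiber z 0 2 * base z 0 3.

Definition Psi (z : 'rV[R]_(5 + 5)) : R :=
  frame_dragging (base z 0 1) (base z 0 4) * p_phi z.

Definition Sigma2 : set 'rV[R]_(5 + 5) :=
  cotangent0 (@spacetime R) `&`
  [set z | base z 0 1 = rs / 2 /\ fiber z 0 0 + Psi z = 0].

(** ** Comparison with Boyer-Lindquist coordinates *)

(** Components in the order [(t, r, theta, phi)]. *)
Definition kerr_metric (r theta : R) : 'M[R]_4 :=
  let S := Sigma r (cos theta) in
  let st2 := sin theta ^+ 2 in
  let diag : 'rV[R]_4 := \row_j
    [:: - (1 - rs * r / S) * c ^+ 2;
        S / (r ^+ 2 - rs * r + spin ^+ 2);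
        S;
        (r ^+ 2 + spin ^+ 2 + rs * r / S * spin ^+ 2 * st2) * st2]`_j in
  diag_mx diag
    - (rs * r * spin * st2 / S * c) *: (delta_mx 0 3 + delta_mx 3 0).

Lemma frame_draggingE (r theta : R) :
  0 < rs -> 0 < c -> 0 < r -> r != rs / 2 -> sin theta != 0 ->
  kerr_metric r theta \in unitmx /\
  frame_dragging r (cos theta) =
    invmx (kerr_metric r theta) 0 3 / invmx (kerr_metric r theta) 0 0.
Proof.
move=> rs0 c0 r0 ra st0.
set G := kerr_metric r theta.
have aE : spin = rs / 2 by [].
have a0 : 0 < spin by rewrite aE; lra.
have rsE : rs = 2 * spin by rewrite aE; field.
set S := Sigma r (cos theta).
have S0 : 0 < S.
  by rewrite /S /Sigma ltr_pwDl ?exprn_gt0// mulr_ge0 ?sqr_ge0.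
set st2 := sin theta ^+ 2.
have st2_gt0 : 0 < st2 by rewrite lt0r sqrf_eq0 st0 sqr_ge0.
have ctE : cos theta ^+ 2 = 1 - st2.
  by rewrite -(cos2Dsin2 theta) addrK.
set E := r ^+ 2 + spin ^+ 2 + rs * r / S * spin ^+ 2 * st2.
have E0 : 0 < E.
  rewrite /E ltr_pwDl ?addr_gt0 ?exprn_gt0//.
  apply: mulr_ge0; last exact: ltW.
  by apply/ltW; rewrite !mulr_gt0 ?invr_gt0.
set Dl := r ^+ 2 - rs * r + spin ^+ 2.
have DlE : Dl = (r - spin) ^+ 2 by rewrite /Dl {1}rsE; ring.
have Dl0 : Dl != 0 by rewrite DlE expf_neq0// subr_eq0.
pose g00 := - (1 - rs * r / S) * c ^+ 2.
pose g33 := E * st2.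
pose g03 := - (rs * r * spin * st2 / S * c).
have detE : g00 * g33 - g03 ^+ 2 = - (c ^+ 2 * Dl * st2).
  have SE : S = r ^+ 2 + spin ^+ 2 * (1 - st2) by rewrite /S /Sigma ctE.
  rewrite /g00 /g33 /g03 /E /Dl.
  have : r ^+ 2 + spin ^+ 2 * (1 - st2) != 0 by rewrite -SE gt_eqF.
  by rewrite SE => ?; field.
set d := g00 * g33 - g03 ^+ 2 in detE.
have d0 : d != 0.
  by rewrite detE oppr_eq0 !mulf_neq0// ?expf_neq0// gt_eqF.
pose H : 'M[R]_4 :=
  diag_mx (\row_j [:: g33 / d; Dl / S; S^-1; g00 / d]`_j)
    - (g03 / d) *: (delta_mx 0 3 + delta_mx 3 0).
have GH : G *m H = 1%:M.
  apply/matrixP => i j; rewrite /G /H /kerr_metric -/S -/st2 -/E -/Dl.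
  rewrite -/g00 -/g33 !mxE !big_ord_recl big_ord0 !mxE.
  rewrite -[rs * r * spin * st2 / S * c]opprK -/g03.
  have Sn0 : S != 0 by rewrite gt_eqF.
  case: i => -[|[|[|[|//]]]] ?; case: j => -[|[|[|[|//]]]] ?;
    rewrite /= ?mulr1n ?mulr0n ?mulr0 ?mul0r ?addr0 ?add0r ?subr0 ?oppr0;
    rewrite ?mulr1 ?mulr0 ?mul0r ?addr0 ?add0r ?subr0 ?oppr0 //;
    by [field; rewrite ?Sn0 ?Dl0 ?d0 | rewrite /d; field; rewrite -/d ?Sn0 ?Dl0 ?d0].
have [Gu _] := mulmx1_unit GH.
have invG : invmx G = H by rewrite -[H](mulKmx Gu) GH mulmx1.
split=> //; rewrite invG /H !mxE /=.
rewrite ?mulr1n ?mulr0n ?addr0 ?add0r ?mulr0 ?mulr1 ?subr0 ?oppr0.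
rewrite /frame_dragging -/S ctE opprB addrCA subrr addr0 -/E /g03 /g33.
field.
by rewrite d0 !gt_eqF.
Qed.

(** The embedding of a coordinate patch of [T^*M], in the coordinates
    [(t, r, theta, phi; p_t, p_r, p_theta, p_phi)]. *)
Definition boyer_lindquist (z : 'rV[R]_(4 + 4)) : 'rV[R]_(5 + 5) :=
  let: (q, p) := (base z, fiber z) in
  let: (st, ct) := (sin (q 0 2), cos (q 0 2)) in
  let: (sp, cp) := (sin (q 0 3), cos (q 0 3)) in
  row_mx
    (\row_j [:: q 0 0; q 0 1; st * cp; st * sp; ct]`_j)
    (\row_j [:: p 0 0; p 0 1;
                p 0 2 * ct * cp - p 0 3 * sp / st;
                p 0 2 * ct * sp + p 0 3 * cp / st;
                - (p 0 2 * st)]`_j).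

(** [boyer_lindquist] pulls [dot p dq] back to [p_mu dq^mu], that is, the
    [p_mu] are dual to the [q^mu]. *)
Lemma tautological_boyer_lindquist (z v : 'rV[R]_(4 + 4)) :
  sin (base z 0 2) != 0 ->
  dot (fiber (boyer_lindquist z)) ('D_v (@base R 5 \o boyer_lindquist) z) =
  dot (fiber z) (base v).
Proof.
move=> st0.
have dq (j : 'I_4) : differentiable (fun x : 'rV[R]_(4 + 4) => base x 0 j) z.
  have -> : (fun x : 'rV[R]_(4 + 4) => base x 0 j) =
            (fun x : 'rV[R]_(4 + 4) => x 0 (lshift 4 j)).
    by apply/funext => y; rewrite /base mxE.
  exact: differentiable_coord.
have Dq (j : 'I_4) : is_derive z v (fun x => base x 0 j) (base v 0 j).
  apply: DeriveDef; first exact: diff_derivable.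
  apply/cvg_lim => //; apply: cvg_near_cst.
  near=> h; rewrite /= /base !mxE addrK [_ *: _]mulrA mulVf ?mul1r//.
  by near: h; exact: nbhs_dnbhs_neq.
have Dcomp (f : R -> R) (j : 'I_4) (b : R) : is_derive (base z 0 j) 1 f b ->
    is_derive z v (fun x => f (base x 0 j)) (base v 0 j * b).
  move=> [df <-]; have /derivable1_diffP df' := df.
  apply: DeriveDef.
    by apply: diff_derivable; apply: (differentiable_comp (dq j)).
  rewrite deriveE; last by apply: (differentiable_comp (dq j)).
  rewrite (diff_comp (dq j) df') /= -deriveE//.
  have [_] := Dq j; rewrite deriveE// => ->.
  by rewrite deriveE// diff1E// derive1E.
have BE x : (@base R 5 \o boyer_lindquist) x =
  \row_k [:: base x 0 0; base x 0 1; sin (base x 0 2) * cos (base x 0 3);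
    sin (base x 0 2) * sin (base x 0 3); cos (base x 0 2)]`_k.
  by rewrite /= /boyer_lindquist [LHS]row_mxKl.
pose D (k : nat) : R := [:: base v 0 0; base v 0 1;
  cos (base z 0 2) * base v 0 2 * cos (base z 0 3)
    - sin (base z 0 2) * sin (base z 0 3) * base v 0 3;
  cos (base z 0 2) * base v 0 2 * sin (base z 0 3)
    + sin (base z 0 2) * cos (base z 0 3) * base v 0 3;
  - sin (base z 0 2) * base v 0 2]`_k.
have HD (k : 'I_5) :
    is_derive z v (fun x => (@base R 5 \o boyer_lindquist) x 0 k) (D k).
  rewrite (_ : (fun _ => _) = fun x => [:: base x 0 0; base x 0 1;
    sin (base x 0 2) * cos (base x 0 3); sin (base x 0 2) * sin (base x 0 3);
    cos (base x 0 2)]`_k); last by apply/funext => x; rewrite BE mxE.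
  have s2 := Dcomp _ 2 _ (is_derive_sin _).
  have c2 := Dcomp _ 2 _ (is_derive_cos _).
  have s3 := Dcomp _ 3 _ (is_derive_sin _).
  have c3 := Dcomp _ 3 _ (is_derive_cos _).
  case: k => -[|[|[|[|[|//]]]]] ?; rewrite /D /=.
  - exact: Dq.
  - exact: Dq.
  - by apply: is_derive_eq (is_deriveM s2 c3) _; rewrite /GRing.scale /=; ring.
  - by apply: is_derive_eq (is_deriveM s2 s3) _; rewrite /GRing.scale /=; ring.
  - by apply: is_derive_eq c2 _; ring.
have HM : derivable (@base R 5 \o boyer_lindquist) z v.
  by apply/derivable_mxP => i k; rewrite (ord1 i); have [] := HD k.
rewrite (derive_mx HM) /dot.
under eq_bigr => k _ do rewrite [X in _ * X]mxE (let: DeriveDef _ e := HD k in e).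
have FE k : fiber (boyer_lindquist z) 0 k =
    [:: fiber z 0 0; fiber z 0 1;
      fiber z 0 2 * cos (base z 0 2) * cos (base z 0 3)
        - fiber z 0 3 * sin (base z 0 3) / sin (base z 0 2);
      fiber z 0 2 * cos (base z 0 2) * sin (base z 0 3)
        + fiber z 0 3 * cos (base z 0 3) / sin (base z 0 2);
      - (fiber z 0 2 * sin (base z 0 2))]`_k.
  by rewrite /boyer_lindquist [fiber (row_mx _ _)]row_mxKr mxE.
rewrite !big_ord_recl !big_ord0 !FE /D /= !addr0.
have -> : ord0 = 0 :> 'I_4 by [].
have -> : lift 0 ord0 = 1 :> 'I_4 by exact: val_inj.
have -> : lift 0 (lift ord0 ord0) = 2 :> 'I_4 by exact: val_inj.
have -> : lift 0 (lift ord0 (lift ord0 ord0)) = 3 :> 'I_4 by exact: val_inj.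
move: (cos2Dsin2 (base z 0 2)) (cos2Dsin2 (base z 0 3)) st0.
move: (cos (base z 0 2)) (sin (base z 0 2)) (cos (base z 0 3)).
move: (sin (base z 0 3)) => s3 c2 s2 c3 e2 e3 s20.
congr (_ + (_ + _)).
transitivity (fiber z 0 2 * base v 0 2 * (c2 ^+ 2 * (c3 ^+ 2 + s3 ^+ 2) + s2 ^+ 2)
              + fiber z 0 3 * base v 0 3 * (c3 ^+ 2 + s3 ^+ 2)); first by field.
by rewrite e3 mulr1 e2 !mulr1.
Unshelve. all: by end_near.
Qed.

Lemma p_phi_boyer_lindquist (z : 'rV[R]_(4 + 4)) :
  sin (base z 0 2) != 0 -> p_phi (boyer_lindquist z) = fiber z 0 3.
Proof.
move=> st0; rewrite /p_phi /boyer_lindquist [base (row_mx _ _)]row_mxKl.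
rewrite [fiber (row_mx _ _)]row_mxKr.
move: (base z) (fiber z) st0 => q p st0; rewrite !mxE /=.
transitivity (p 0 3 * (cos (q 0 3) ^+ 2 + sin (q 0 3) ^+ 2)); first by field.
by rewrite cos2Dsin2 mulr1.
Qed.

End Kerr.

(* Main.v *)
Require Import Defs.
From mathcomp Require Import all_boot all_order all_algebra.
From mathcomp Require Import all_classical all_reals all_analysis.
From mathcomp Require Import ring lra.
Import Order.TTheory GRing.Theory Num.Theory.
Import numFieldNormedType.Exports.
Local Open Scope classical_set_scope.
Local Open Scope ring_scope.

(** On the horizon [r = rs / 2] the frame-dragging coefficient is the constant
    [c / rs], so [Sigma2] is cut out of the cotangent bundle by the functions
    [r - rs / 2] and [h = p_t + (c / rs) p_phi].  Stereographic coordinates on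
    the sphere, with suitable momenta, turn these two functions and the two
    constraints [|x| = 1], [x . p = 0] into coordinates of a rational chart
    with rational inverse, whence the submanifold property.

    The tangent space of [Sigma2] is the common kernel of the differentials of
    these four functions: a vector in the kernel is the velocity of a curve
    that follows a rational parametrization of a great circle on the sphere,
    projects the momentum to its tangent plane, and solves [h = 0] for [p_t].
    The Hamiltonian vector fields [d/dp_r] and
    [d/dt + (c / rs) d/dphi] of the two functions lie in that kernel.  A vector
    tangent to the cotangent bundle and orthogonal to both is annihilated by
    [dr] and [dh], hence is tangent to [Sigma2]. *)

(** * Calculus of smooth maps on open sets *)

Section Smooth.
Context {R : realType}.

Section Calculus.
Context {V : normedModType R}.
Variable U : set V.
Hypothesis oU : open U.

Lemma near_open (x : V) : U x -> \forall y \near x, U y.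
Proof. by move=> Ux; apply: open_nbhs_nbhs; split. Qed.

(** Since [U] is open, agreement on [U] is agreement near each of its points, so limits and
    derivatives there coincide. The inductions below use this to replace a derivative by its closed
    formula on [U]. *)
Lemma Ck_ext {W : normedModType R} (k : nat) (f g : V -> W) :
  (forall x, U x -> f x = g x) -> Ck k U f -> Ck k U g.
Proof.
elim: k f g => [|k IH] f g fg /= Cf.
  move=> x Ux; suff : g @ x --> f x by rewrite (fg x Ux).
  apply: cvg_trans (Cf x Ux); apply: near_eq_cvg.
  by apply: filterS (near_open _ Ux) => y Uy; rewrite fg.
move=> v; have [df Ckf] := Cf v.
have fgn x : U x -> \forall y \near x, f y = g y.
  by move=> Ux; apply: filterS (near_open _ Ux) => y Uy; exact: fg.
split=> [x Ux|]; first by apply: near_eq_derivable (df x Ux); exact: fgn.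
by apply: IH Ckf => x Ux; apply: near_eq_derive; exact: fgn.
Qed.

Lemma smooth_continuous {W : normedModType R} (f : V -> W) x :
  smooth_on U f -> U x -> {for x, continuous f}.
Proof. by move=> sf; exact: (sf 0%N). Qed.

Lemma smooth_derivable {W : normedModType R} (f : V -> W) x v :
  smooth_on U f -> U x -> derivable f x v.
Proof. by move=> sf; have [df _] := sf 1%N v; exact: df. Qed.

Lemma smooth_derive {W : normedModType R} (f : V -> W) v :
  smooth_on U f -> smooth_on U ('D_v f).
Proof. by move=> sf k; have [_] := sf k.+1 v. Qed.

Lemma smooth_cst {W : normedModType R} (w : W) : smooth_on U (fun _ : V => w).
Proof.
move=> k; elim: k w => [|k IH] w /=; first by move=> x _; exact: cvg_cst.
move=> v; split=> [x _|]; first exact: derivable_cst.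
by apply: Ck_ext (IH 0) => x _; rewrite (derive_cst w).
Qed.

Lemma CkD {W : normedModType R} k (f g : V -> W) :
  Ck k U f -> Ck k U g -> Ck k U (f + g).
Proof.
elim: k f g => [|k IH] f g /= Cf Cg.
  by move=> x Ux; apply: continuousD; [exact: Cf|exact: Cg].
move=> v; have [df Ckf] := Cf v; have [dg Ckg] := Cg v.
split=> [x Ux|]; first by apply: derivableD; [exact: df|exact: dg].
apply: Ck_ext (IH _ _ Ckf Ckg) => x Ux.
by rewrite deriveD; [|exact: df|exact: dg].
Qed.

Lemma smoothD {W : normedModType R} (f g : V -> W) :
  smooth_on U f -> smooth_on U g -> smooth_on U (fun x => f x + g x).
Proof. by move=> sf sg k; apply: CkD. Qed.

Lemma smoothM (f g : V -> R) :
  smooth_on U f -> smooth_on U g -> smooth_on U (fun x => f x * g x).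
Proof.
(* The induction keeps [f] and [g] smooth: the Leibniz formula brings them back undifferentiated,
   and [Ck k.+1] does not directly give [Ck k]. *)
move=> sf sg k; elim: k f g sf sg => [|k IH] f g sf sg /=.
  by move=> x Ux; apply: continuousM; apply: smooth_continuous.
move=> v; split=> [x Ux|].
  by apply: derivableM; apply: smooth_derivable.
apply: (@Ck_ext _ _ ((fun x => f x * 'D_v g x) + (fun x => g x * 'D_v f x))).
  by move=> x Ux; rewrite deriveM//; exact: smooth_derivable.
by apply: CkD; apply: IH => //; exact: smooth_derive.
Qed.

Lemma smoothN (f : V -> R) : smooth_on U f -> smooth_on U (fun x => - f x).
Proof.
move=> sf; rewrite (_ : (fun _ => _) = fun x => -1 * f x).
  by apply: smoothM => //; exact: smooth_cst.
by apply/funext => x; rewrite mulN1r.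
Qed.

Lemma smoothB (f g : V -> R) :
  smooth_on U f -> smooth_on U g -> smooth_on U (fun x => f x - g x).
Proof. by move=> sf sg; apply: smoothD => //; exact: smoothN. Qed.

Lemma smoothX (f : V -> R) n : smooth_on U f -> smooth_on U (fun x => f x ^+ n).
Proof.
move=> sf; elim: n => [|n IH]; first exact: smooth_cst.
by under eq_fun do rewrite exprS; exact: smoothM.
Qed.

(** The derivative of a quotient is again a quotient, with denominator [g ^+ 2], so the induction
    ranges over all pairs [f], [g]. *)
Lemma smooth_div (f g : V -> R) : (forall x, U x -> g x != 0) ->
  smooth_on U f -> smooth_on U g -> smooth_on U (fun x => f x / g x).
Proof.
move=> g0 sf sg k; elim: k f g g0 sf sg => [|k IH] f g g0 sf sg.
  move=> x Ux; apply: continuousM; first exact: smooth_continuous.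
  by apply: continuousV; [exact: g0|exact: smooth_continuous].
move=> v; have dVg x : U x -> derivable (fun y => (g y)^-1) x v.
  by move=> Ux; apply: derivableV; [exact: g0|exact: smooth_derivable].
split=> [x Ux|].
  by apply: derivableM; [exact: smooth_derivable|exact: dVg].
apply: (@Ck_ext _ _ (fun x => ('D_v f x * g x - f x * 'D_v g x) / g x ^+ 2)).
  move=> x Ux; rewrite (deriveM _ (dVg _ Ux)); last exact: smooth_derivable.
  rewrite deriveV; [|exact: g0|exact: smooth_derivable].
  by rewrite /GRing.scale /=; field; exact: g0.
apply: IH; last exact: smoothX.
  by move=> x Ux; rewrite expf_neq0//; exact: g0.
by apply: smoothB; apply: smoothM => //; exact: smooth_derive.
Qed.

(** Each directional derivative is constant, which settles all positive orders. Continuity is a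
    separate assumption because directional derivatives alone do not give it in a general normed
    space. *)
Lemma smooth_linear (f : V -> R) (g : V -> R) :
  continuous f -> (forall x v, is_derive x v f (g v)) -> smooth_on U f.
Proof.
move=> cf df [|k]; first by move=> x _; exact: cf.
move=> v; split=> [x _|]; first by have [] := df x v.
by apply: Ck_ext (smooth_cst (g v) k) => x _; have [_ ->] := df x v.
Qed.

Lemma smooth_row n (f : 'I_n -> V -> R) :
  (forall j, smooth_on U (f j)) -> smooth_on U (fun x => \row_j f j x).
Proof.
move=> sf k; elim: k f sf => [|k IH] f sf.
  move=> x Ux A [B nB BA]; have nj (j : 'I_n) : \forall y \near x, B 0 j (f j y).
    by apply: (smooth_continuous _ _ (sf j) Ux); have := nB 0 j; rewrite mxE.
  suff : \forall y \near x, A (\row_j f j y) by [].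
  near=> y; apply: BA => i j; rewrite mxE (ord1 i); move: j.
  by near: y; exact: filter_forall.
move=> v; have dF x : U x -> derivable (fun x => \row_j f j x) x v.
  move=> Ux; apply/derivable_mxP => i j; under eq_fun do rewrite mxE.
  exact: smooth_derivable.
split=> //; apply: Ck_ext (IH (fun j => 'D_v (f j)) _) => [x Ux|j].
  rewrite derive_mx; last exact: dF.
  by apply/rowP => j; rewrite !mxE; under [in RHS]eq_fun do rewrite mxE.
exact: smooth_derive.
Unshelve. all: by end_near.
Qed.

End Calculus.

Lemma smooth_subset {V W : normedModType R} (A B : set V) (f : V -> W) :
  A `<=` B -> smooth_on B f -> smooth_on A f.
Proof.
move=> AB sf k; elim: k f sf => [|k IH] f sf.
  by move=> x /AB; exact: (sf 0%N).
move=> v; split=> [x /AB|]; first by have [+ _] := sf 1%N v; apply.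
by apply: IH => j; have [_] := sf j.+1 v.
Qed.

Lemma smooth_id (U : set R) : open U -> smooth_on U (fun x : R => x).
Proof.
by move=> oU; apply: (smooth_linear _ oU _ id) => x; exact: cvg_id.
Qed.

Lemma is_derive_coord n (i : 'I_n) (x v : 'rV[R]_n) :
  is_derive x v (fun y : 'rV[R]_n => y 0 i) (v 0 i).
Proof.
have dc : differentiable (fun y : 'rV[R]_n => y 0 i) x.
  exact: differentiable_coord.
apply: DeriveDef; first exact: diff_derivable.
apply/cvg_lim => //; apply: cvg_near_cst.
near=> h; rewrite /= !mxE addrK [_ *: _]mulrA mulVf ?mul1r//.
by near: h; exact: nbhs_dnbhs_neq.
Unshelve. all: by end_near.
Qed.

Lemma smooth_coord n (U : set 'rV[R]_n) (i : 'I_n) :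
  open U -> smooth_on U (fun x : 'rV[R]_n => x 0 i).
Proof.
move=> oU; apply: (smooth_linear _ oU _ (fun v => v 0 i)).
  by move=> x; exact: coord_continuous.
by move=> x v; exact: is_derive_coord.
Qed.
End Smooth.

(** * Positions, momenta, and restriction of diffeomorphisms *)

Section Coordinates.
Context {R : realType}.

Lemma base_row_mx n (q p : 'rV[R]_n) : base (row_mx q p) = q.
Proof. exact: row_mxKl. Qed.

Lemma fiber_row_mx n (q p : 'rV[R]_n) : fiber (row_mx q p) = p.
Proof. exact: row_mxKr. Qed.

Lemma row_mx_base_fiber n (z : 'rV[R]_(n + n)) : row_mx (base z) (fiber z) = z.
Proof. exact: hsubmxK. Qed.

Lemma eq_base_fiber n (u v : 'rV[R]_(n + n)) :
  base u = base v -> fiber u = fiber v -> u = v.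
Proof. by move=> e f; rewrite -[u]row_mx_base_fiber e f row_mx_base_fiber. Qed.

Lemma continuous_fiber n (i : 'I_n) :
  continuous (fun z : 'rV[R]_(n + n) => fiber z 0 i).
Proof.
move=> z; under [X in continuous_at _ X]eq_fun do rewrite mxE.
exact: coord_continuous.
Qed.

Lemma smooth_base n (U : set 'rV[R]_(n + n)) (i : 'I_n) :
  open U -> smooth_on U (fun z => base z 0 i).
Proof.
by move=> oU; under eq_fun do rewrite mxE; exact: smooth_coord.
Qed.

Lemma smooth_fiber n (U : set 'rV[R]_(n + n)) (i : 'I_n) :
  open U -> smooth_on U (fun z => fiber z 0 i).
Proof.
by move=> oU; under eq_fun do rewrite mxE; exact: smooth_coord.
Qed.

Lemma smooth_row_mx {V : normedModType R} (U : set V) n (f g : 'I_n -> V -> R) :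
  open U -> (forall j, smooth_on U (f j)) -> (forall j, smooth_on U (g j)) ->
  smooth_on U (fun x => row_mx (\row_j f j x) (\row_j g j x)).
Proof.
move=> oU sf sg; rewrite (_ : (fun _ => _) = fun x =>
  \row_(k < n + n)
    match fintype.split k with inl j => f j x | inr j => g j x end).
  by apply: smooth_row => // k; case: fintype.split.
by apply/funext => x; apply/rowP => k; rewrite !mxE;
  case: fintype.split => j; rewrite mxE.
Qed.

(** The image of [U] is the part of [V0] that [psi] sends into [U], and this is open because [psi]
    is continuous on [V0]. *)
Lemma diffeo_onI n (U0 V0 U : set 'rV[R]_n) (phi psi : 'rV[R]_n -> 'rV[R]_n) :
  open V0 -> smooth_on U0 phi -> smooth_on V0 psi ->
  (forall x, U0 x -> V0 (phi x) /\ psi (phi x) = x) ->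
  (forall y, V0 y -> phi (psi y) = y) ->
  open U -> U `<=` U0 -> diffeo_on U phi.
Proof.
move=> oV0 sphi spsi phiK psiK oU UU0.
have VE : phi @` U = V0 `&` psi @^-1` U.
  apply/seteqP; split=> [_ [x Ux <-]|y [Vy Uy]]; last first.
    by exists (psi y) => //; exact: psiK.
  by have [Vx e] := phiK x (UU0 _ Ux); split; rewrite //= e.
split=> //.
- rewrite VE openE => y [Vy Uy]; apply: filterI.
    by apply: open_nbhs_nbhs; split.
  by apply: (smooth_continuous _ _ _ spsi Vy); apply: open_nbhs_nbhs; split.
- exact: smooth_subset UU0 sphi.
- exists psi; split.
    by apply: (smooth_subset _ _ _ _ spsi); rewrite VE; exact: subIsetl.
  by move=> x /UU0 /phiK[].
Qed.

End Coordinates.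

(** Quotients are matched before products, since [f / g] is itself a product with an inverse.
    Nonvanishing of denominators is left as a goal. *)
Ltac smooth_tac :=
  repeat lazymatch goal with
  | |- open _ => eassumption
  | |- smooth_on _ (fun _ => ?w) => apply: (smooth_cst _ _ w)
  | |- smooth_on _ (fun x => fun_of_matrix (base x) _ _) => apply: smooth_base
  | |- smooth_on _ (fun x => fun_of_matrix (fiber x) _ _) => apply: smooth_fiber
  | |- smooth_on _ (fun x => x) => apply: smooth_id
  | |- smooth_on _ (fun x => @?f x / @?g x) => apply: (smooth_div _ _ f g)
  | |- smooth_on _ (fun x => @?f x * @?g x) => apply: (smoothM _ _ f g)
  | |- smooth_on _ (fun x => @?f x + @?g x) => apply: (smoothD _ _ f g)
  | |- smooth_on _ (fun x => - @?f x) => apply: (smoothN _ _ f)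
  | |- smooth_on _ (fun x => @?f x ^+ _) => apply: (smoothX _ _ f)
  end.

(** * A stereographic chart of the ambient space R^10 *)

Section Chart.
Context {R : realType}.
Variables ep a Om : R.

(** Stereographic projection from [(0, 0, - ep)], where [ep] is [1] or [-1]. *)
Definition stereo (z : 'rV[R]_(5 + 5)) (i : 'I_5) : R :=
  base z 0 i / (1 + ep * base z 0 4).

(** With [x] the point of the sphere of stereographic coordinates [(w1, w2)],
    the last component is [p . x]; the one before it is
    [(|x|^2 - 1) / (1 + ep * x3)]. *)
Definition chart (z : 'rV[R]_(5 + 5)) : 'rV[R]_(5 + 5) :=
  let w1 := stereo z 2 in let w2 := stereo z 3 in
  let W := w1 ^+ 2 + w2 ^+ 2 in
  let P1 := fiber z 0 2 - w1 * (ep * fiber z 0 4) in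
  let P2 := fiber z 0 3 - w2 * (ep * fiber z 0 4) in
  row_mx
    (\row_j [:: base z 0 0; w1; w2; fiber z 0 1; P1]`_j)
    (\row_j [:: P2; base z 0 1 - a;
                fiber z 0 0 + Om * (fiber z 0 3 * base z 0 2
                                    - fiber z 0 2 * base z 0 3);
                ep * base z 0 4 * (1 + W) + W - 1;
                ep * fiber z 0 4 + 2 * (w1 * P1 + w2 * P2) / (1 + W)]`_j).

(** Here [l] recovers [1 + ep * x3] and [p3] recovers [ep] times the third sphere momentum. In the
    angular momentum the terms [w_i * p3] cancel, leaving [(P2 * w1 - P1 * w2) * l]. *)
Definition chart_inv (y : 'rV[R]_(5 + 5)) : 'rV[R]_(5 + 5) :=
  let w1 := base y 0 1 in let w2 := base y 0 2 in
  let W := w1 ^+ 2 + w2 ^+ 2 in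
  let P1 := base y 0 4 in let P2 := fiber y 0 0 in
  let l := (fiber y 0 3 + 2) / (1 + W) in
  let p3 := fiber y 0 4 - 2 * (w1 * P1 + w2 * P2) / (1 + W) in
  row_mx
    (\row_j [:: base y 0 0; fiber y 0 1 + a; w1 * l; w2 * l; ep * (l - 1)]`_j)
    (\row_j [:: fiber y 0 2 - Om * ((P2 * w1 - P1 * w2) * l);
                base y 0 3; P1 + w1 * p3; P2 + w2 * p3; ep * p3]`_j).

Lemma one_add_sqr_neq0 (x y : R) : 1 + (x ^+ 2 + y ^+ 2) != 0.
Proof. by rewrite gt_eqF// ltr_pwDl// addr_ge0// sqr_ge0. Qed.

Lemma smooth_chart (U : set 'rV[R]_(5 + 5)) : open U ->
  (forall z, U z -> 1 + ep * base z 0 4 != 0) -> smooth_on U chart.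
Proof.
move=> oU U0; apply: (smooth_row_mx _ _
  (fun j z => _) (fun j z => _)) => // -[[|[|[|[|[|//]]]]] ?] /=;
  rewrite /stereo; smooth_tac => // *;
  first [exact: one_add_sqr_neq0|exact: U0].
Qed.

Lemma smooth_chart_inv (V : set 'rV[R]_(5 + 5)) : open V ->
  smooth_on V chart_inv.
Proof.
move=> oV; apply: (smooth_row_mx _ _
  (fun j z => _) (fun j z => _)) => // -[[|[|[|[|[|//]]]]] ?] /=;
  smooth_tac => // *; exact: one_add_sqr_neq0.
Qed.

Hypothesis ep2 : ep * ep = 1.

Lemma rowP5 (u v : 'rV[R]_5) : u 0 0 = v 0 0 -> u 0 1 = v 0 1 ->
  u 0 2 = v 0 2 -> u 0 3 = v 0 3 -> u 0 4 = v 0 4 -> u = v.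
Proof.
move=> e0 e1 e2 e3 e4; apply/rowP => -[[|[|[|[|[|//]]]]] i].
- by move: e0; congr (u 0 _ = v 0 _); apply/val_inj.
- by move: e1; congr (u 0 _ = v 0 _); apply/val_inj.
- by move: e2; congr (u 0 _ = v 0 _); apply/val_inj.
- by move: e3; congr (u 0 _ = v 0 _); apply/val_inj.
- by move: e4; congr (u 0 _ = v 0 _); apply/val_inj.
Qed.

Lemma row5E (s : seq R) (i : 'I_5) : (\row_(j < 5) s`_j) 0 i = s`_i.
Proof. exact: mxE. Qed.

Lemma chartK z : 1 + ep * base z 0 4 != 0 ->
  fiber (chart z) 0 3 + 2 != 0 /\ chart_inv (chart z) = z.
Proof.
move=> z0; have epE : ep ^+ 2 = 1 by rewrite expr2.
have W0 := one_add_sqr_neq0 (stereo z 2) (stereo z 3).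
(* Adding 2 to the sphere constraint coordinate makes it factor, so that [1 + ep * x3] can be read
   off without assuming [|x| = 1]. *)
have lE : fiber (chart z) 0 3 + 2 =
    (1 + ep * base z 0 4) * (1 + (stereo z 2 ^+ 2 + stereo z 3 ^+ 2)).
  by rewrite /chart fiber_row_mx row5E /=; ring.
split; first by rewrite lE mulf_neq0.
have l1 : (fiber (chart z) 0 3 + 2) / (1 + (stereo z 2 ^+ 2 + stereo z 3 ^+ 2)) =
  1 + ep * base z 0 4 by rewrite lE mulfK.
have x1E : stereo z 2 * (1 + ep * base z 0 4) = base z 0 2 by rewrite mulfVK.
have x2E : stereo z 3 * (1 + ep * base z 0 4) = base z 0 3 by rewrite mulfVK.
rewrite /chart_inv; set l := (_ / _); have -> : l = 1 + ep * base z 0 4.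
  by rewrite -l1 /l /chart base_row_mx !row5E.
rewrite /chart base_row_mx fiber_row_mx !row5E /= addrK.
by apply: eq_base_fiber; rewrite ?base_row_mx ?fiber_row_mx; apply: rowP5;
  rewrite row5E /=; move: (stereo z 2) (stereo z 3) x1E x2E => w1 w2 e1 e2;
  rewrite -?e1 -?e2;   ring: epE.
Qed.

Lemma chart_invK y : fiber y 0 3 + 2 != 0 ->
  1 + ep * base (chart_inv y) 0 4 != 0 /\ chart (chart_inv y) = y.
Proof.
move=> y0; have epE : ep ^+ 2 = 1 by rewrite expr2.
have W0 := one_add_sqr_neq0 (base y 0 1) (base y 0 2).
have lE : 1 + ep * base (chart_inv y) 0 4 =
    (fiber y 0 3 + 2) / (1 + (base y 0 1 ^+ 2 + base y 0 2 ^+ 2)).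
  by rewrite /chart_inv base_row_mx row5E /= mulrA ep2 mul1r subrKC.
have l0 : 1 + ep * base (chart_inv y) 0 4 != 0.
  by rewrite lE mulf_neq0// invr_neq0.
split=> //.
have w1E : stereo (chart_inv y) 2 = base y 0 1.
  by rewrite /stereo lE /chart_inv base_row_mx row5E /= mulfK// -lE.
have w2E : stereo (chart_inv y) 3 = base y 0 2.
  by rewrite /stereo lE /chart_inv base_row_mx row5E /= mulfK// -lE.
rewrite /chart w1E w2E /chart_inv base_row_mx fiber_row_mx !row5E /=.
by apply: eq_base_fiber; rewrite ?base_row_mx ?fiber_row_mx; apply: rowP5;
  rewrite row5E /=; field: epE.
Qed.
End Chart.

(** * Tangent vectors of the spacetime and of its cotangent bundle *)

Section Tangent.
Context {R : realType}.

Lemma tangentP n (S : set 'rV[R]_n) (x v : 'rV[R]_n) : tangent S x v ->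
  exists gamma : R -> 'rV[R]_n,
    [/\ gamma 0 = x,
        forall i, is_derive (0 : R) 1 (fun s => gamma s 0 i) (v 0 i) &
        \forall s \near (0 : R), S (gamma s)].
Proof.
move=> [gamma [e [e0 sg Sg g0 dg]]]; exists gamma.
have I0 : (`]- e, e[%classic : set R) 0 by rewrite /= in_itv /= oppr_lt0 e0.
have dg0 := smooth_derivable _ gamma 0 (1 : R) sg I0.
split=> // [i|].
- apply: DeriveDef; first by have /derivable_mxP := dg0; apply.
  by rewrite -dg derive_mx// mxE.
- suff : \forall s \near (0 : R), `]- e, e[%classic s by apply: filterS.
  by apply: near_open => //; exact: itv_open.
Qed.

Lemma tangent_curve n (S : set 'rV[R]_n) (x v : 'rV[R]_n)
    (gamma : R -> 'rV[R]_n) :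
  smooth_on setT gamma -> gamma 0 = x ->
  (forall i, is_derive (0 : R) 1 (fun s => gamma s 0 i) (v 0 i)) ->
  (\forall s \near (0 : R), S (gamma s)) -> tangent S x v.
Proof.
move=> sg g0 dg /nbhs_ballP[e /= e0 eS]; exists gamma, e; split=> //.
- by apply: smooth_subset sg.
- move=> s; rewrite /= in_itv /= => /andP[s1 s2]; apply: eS.
  by rewrite /ball /= sub0r normrN ltr_norml s1.
- rewrite derive_mx; last first.
    by apply/derivable_mxP => i j; rewrite (ord1 i); have [] := dg j.
  by apply/rowP => j; rewrite mxE; have [_ ->] := dg j.
Qed.

Lemma is_derive_near_cst (f : R -> R) (k d : R) :
  (\forall s \near (0 : R), f s = k) -> is_derive (0 : R) 1 f d -> d = 0.
Proof.
move=> fk [_ <-]; rewrite (near_eq_derive _ (g := cst k))//; exact: derive_cst.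
Qed.

(** Reads a velocity at [0] off a first-order expansion with smooth remainder, so that the quotient
    in [sphere_curve] need not be differentiated. *)
Lemma is_derive_quadratic (f g : R -> R) (b d : R) : smooth_on setT g ->
  (forall s, f s = b + s * d + s ^+ 2 * g s) -> is_derive (0 : R) 1 f d.
Proof.
move=> sg fE; have dg := derivableP (smooth_derivable _ g 0 (1 : R) sg I).
have -> : f = cst b + (id * cst d) + (id * (id * g)) :> (R -> R).
  by apply/funext => s; rewrite fE expr2 !fctE mulrA.
have di := is_derive_id (0 : R) (1 : R).
apply: (is_derive_eq (is_deriveD (is_deriveD (is_derive_cst b _ _)
  (is_deriveM di (is_derive_cst d _ _))) (is_deriveM di (is_deriveM di dg)))).
by rewrite !fctE /GRing.scale /= ?mul0r ?mulr1 ?add0r ?addr0.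
Qed.

Definition sdot (u v : 'rV[R]_5) : R :=
  u 0 2 * v 0 2 + u 0 3 * v 0 3 + u 0 4 * v 0 4.

(** The rational parametrization [((1 - t^2) q + 2 t e) / (1 + t^2)] of the
    great circle through [q] in the direction of the unit vector [e = v / |v|],
    with [t = s |v| / 2]. *)
Definition sphere_curve (q v : 'rV[R]_5) (i : 'I_5) (s : R) : R :=
  let k := sdot v v / 4 in
  ((1 - k * s ^+ 2) * q 0 i + s * v 0 i) / (1 + k * s ^+ 2).

Lemma sdot_ge0 v : 0 <= sdot v v.
Proof. by rewrite /sdot -!expr2 !addr_ge0// sqr_ge0. Qed.

Lemma sphere_curve_den (v : 'rV[R]_5) (s : R) : 1 + sdot v v / 4 * s ^+ 2 != 0.
Proof.
by rewrite gt_eqF// ltr_pwDl// mulr_ge0 ?sqr_ge0// divr_ge0// sdot_ge0.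
Qed.

Lemma smooth_sphere_curve q v i : smooth_on setT (sphere_curve q v i).
Proof.
have oT := @openT R; rewrite /sphere_curve; smooth_tac => x _.
exact: sphere_curve_den.
Qed.

Lemma sphere_curve0 q v i : sphere_curve q v i 0 = q 0 i.
Proof. by rewrite /sphere_curve expr0n mulr0 mul0r subr0 !addr0 mul1r divr1. Qed.

Lemma is_derive_sphere_curve q v i :
  is_derive (0 : R) 1 (sphere_curve q v i) (v 0 i).
Proof.
have oT := @openT R; pose k := sdot v v / 4.
apply: (is_derive_quadratic _
  (fun s => - (2 * k * q 0 i + k * s * v 0 i) / (1 + k * s ^+ 2)) (q 0 i)).
  by smooth_tac => x _; exact: sphere_curve_den.
by move=> s; have := sphere_curve_den v s; rewrite /sphere_curve -/k => ?; field.
Qed.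

Lemma sphere_curve_unit q v s : sdot q q = 1 -> sdot q v = 0 ->
  sphere_curve q v 2 s ^+ 2 + sphere_curve q v 3 s ^+ 2
    + sphere_curve q v 4 s ^+ 2 = 1.
Proof.
move=> q1 qv; have := sphere_curve_den v s; rewrite /sphere_curve.
have vE : sdot v v = 4 * (sdot v v / 4) by field.
move: (sdot v v / 4) vE => k vE D0.
(* As [sdot v v = 4 * k], the numerator becomes [(1 - k s^2)^2 + 4 k s^2 = (1 + k s^2)^2]. *)
transitivity (((1 - k * s ^+ 2) ^+ 2 * sdot q q + s ^+ 2 * sdot v v
  + 2 * (1 - k * s ^+ 2) * s * sdot q v) / (1 + k * s ^+ 2) ^+ 2).
  by rewrite /sdot; field.
by rewrite q1 qv vE; field.
Qed.

Lemma is_derive_affine (x v : R) : is_derive (0 : R) 1 (fun s => x + s * v) v.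
Proof.
apply: (is_derive_quadratic _ (fun=> 0) x); first exact: (smooth_cst _ openT).
by move=> s; rewrite mulr0 addr0.
Qed.

Lemma near_affine_gt0 (x v : R) :
  0 < x -> \forall s \near (0 : R), 0 < x + s * v.
Proof.
move=> x0; have sa : smooth_on setT (fun s : R => x + s * v).
  by have oT := @openT R; smooth_tac.
have cs : (fun s => x + s * v) @ (0 : R) --> x + 0 * v.
  exact: (smooth_continuous _ _ _ sa I).
by apply: (cvgr_gt _ cs); rewrite mul0r addr0.
Qed.

Lemma row_eta5 (q : 'rV[R]_5) :
  q = \row_j [:: q 0 0; q 0 1; q 0 2; q 0 3; q 0 4]`_j.
Proof. by apply: rowP5; rewrite row5E. Qed.

(** One direction differentiates [|x|^2 = 1]; for the other, [t] and [r] move affinely and the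
    sphere point follows [sphere_curve], with [r] positive for small times. *)
Lemma tangent_spacetime (q v : 'rV[R]_5) : spacetime q ->
  tangent (@spacetime R) q v <-> sdot q v = 0.
Proof.
move=> [r0 q1]; have oT := @openT R; split=> [|qv].
  move=> /tangentP[g [g0 dg Sg]].
  have : \forall s \near (0 : R),
      g s 0 2 * g s 0 2 + g s 0 3 * g s 0 3 + g s 0 4 * g s 0 4 = 1.
    by apply: filterS Sg => s [_]; rewrite !expr2.
  move/is_derive_near_cst => /(_ _ (is_deriveD
    (is_deriveD (is_deriveM (dg 2) (dg 2)) (is_deriveM (dg 3) (dg 3)))
    (is_deriveM (dg 4) (dg 4)))).
  by rewrite /GRing.scale /= g0 /sdot; lra.
have qq : sdot q q = 1 by rewrite /sdot -!expr2.
apply: (tangent_curve _ _ _ _ (fun s => \row_j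
  [:: q 0 0 + s * v 0 0; q 0 1 + s * v 0 1; sphere_curve q v 2 s;
      sphere_curve q v 3 s; sphere_curve q v 4 s]`_j)).
- apply: (smooth_row _ _ _ (fun j s => _)) => // -[[|[|[|[|[|//]]]]] ?] /=;
    try exact: smooth_sphere_curve; smooth_tac.
- by rewrite [RHS]row_eta5 !mul0r !addr0 !sphere_curve0.
- move=> i; under eq_fun do rewrite row5E.
  have -> : v 0 i = [:: v 0 0; v 0 1; v 0 2; v 0 3; v 0 4]`_i.
    by rewrite {1}[v]row_eta5 row5E.
  case: i => -[|[|[|[|[|//]]]]] ? /=;
    first [exact: is_derive_affine|exact: is_derive_sphere_curve].
- apply: filterS (near_affine_gt0 _ (v 0 1) r0) => s s0.
  by split; rewrite !row5E //=; exact: sphere_curve_unit.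
Qed.

Lemma cotangentE (z : 'rV[R]_(5 + 5)) : cotangent (@spacetime R) z <->
  [/\ 0 < base z 0 1, sdot (base z) (base z) = 1 & sdot (base z) (fiber z) = 0].
Proof.
rewrite /cotangent /=; split.
  move=> [zM]; rewrite (tangent_spacetime _ _ zM) => zt; case: zM => r0 q1.
  by split=> //; rewrite /sdot -!expr2.
move=> [r0]; rewrite {1}/sdot -!expr2 => q1 zt.
have zM : spacetime (base z) by split.
by split=> //; apply/tangent_spacetime.
Qed.

Lemma tangent_cotangent (z v : 'rV[R]_(5 + 5)) :
  tangent (cotangent (@spacetime R)) z v ->
  sdot (base z) (base v) = 0 /\
  sdot (base v) (fiber z) + sdot (base z) (fiber v) = 0.
Proof.
move=> /tangentP[g [g0 dg Sg]].
have db i : is_derive (0 : R) 1 (fun s => base (g s) 0 i) (base v 0 i).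
  by rewrite [base v]/base mxE; under eq_fun do rewrite mxE.
have df i : is_derive (0 : R) 1 (fun s => fiber (g s) 0 i) (fiber v 0 i).
  by rewrite [fiber v]/fiber mxE; under eq_fun do rewrite mxE.
have d (u w : R -> 'rV[R]_5) (u' w' : 'rV[R]_5) :
    (forall i, is_derive (0 : R) 1 (fun s => u s 0 i) (u' 0 i)) ->
    (forall i, is_derive (0 : R) 1 (fun s => w s 0 i) (w' 0 i)) ->
    is_derive (0 : R) 1 (fun s => sdot (u s) (w s))
      (sdot u' (w 0) + sdot (u 0) w').
  move=> du dw; rewrite /sdot.
  apply: (is_derive_eq (is_deriveD (is_deriveD (is_deriveM (du 2) (dw 2))
    (is_deriveM (du 3) (dw 3))) (is_deriveM (du 4) (dw 4)))).
  by rewrite /GRing.scale /= /sdot; ring.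
have dbb := d _ _ _ _ db db; have dbf := d _ _ _ _ db df.
have nb : \forall s \near (0 : R), sdot (base (g s)) (base (g s)) = 1.
  by apply: filterS Sg => s /cotangentE[].
have nf : \forall s \near (0 : R), sdot (base (g s)) (fiber (g s)) = 0.
  by apply: filterS Sg => s /cotangentE[].
have := is_derive_near_cst _ _ _ nb dbb; have := is_derive_near_cst _ _ _ nf dbf.
by rewrite g0 => -> ; rewrite /sdot => ?; split => //; lra.
Qed.

End Tangent.

(** * Equations of [Sigma2] on the horizon *)

Section Sigma2.
Context {R : realType}.

Lemma open_fiber_neq0 n : open [set z : 'rV[R]_(n + n) | fiber z != 0].
Proof.
rewrite openE => z /= z0.
have [i zi] : exists i, fiber z 0 i != 0.
  apply/existsP; apply: contraNT z0; rewrite negb_exists => /forallP z0.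
  by apply/eqP/rowP => i; rewrite [RHS]mxE; apply/eqP; rewrite -[_ == _]negbK.
have nzi : \forall y \near fiber z 0 i, y != 0.
  by apply: open_nbhs_nbhs; split=> //; exact: open_neq.
suff : \forall y \near z, fiber y != 0 by [].
near=> y; have : fiber y 0 i != 0.
  by near: y; exact: (continuous_fiber _ i z _ nzi).
by apply: contraNN => /eqP ->; rewrite mxE.
Unshelve. all: by end_near.
Qed.

Variables rs c : R.
Hypothesis rs_gt0 : 0 < rs.

(** There [r] equals [spin], so the denominator is [rs^2 / (1 + ct^2)] and [rs * r / Sigma] is
    [2 / (1 + ct^2)]: the dependence on the angle cancels. *)
Lemma frame_dragging_horizon (ct : R) : frame_dragging rs c (rs / 2) ct = c / rs.
Proof.
have rs0 : rs != 0 by rewrite gt_eqF.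
have ct0 : 1 + ct ^+ 2 != 0 by rewrite gt_eqF// ltr_pwDl// sqr_ge0.
have SE : Sigma rs (rs / 2) ct = (rs / 2) ^+ 2 * (1 + ct ^+ 2).
  by rewrite /Sigma /spin; ring.
rewrite /frame_dragging SE /spin.
have -> : (rs / 2) ^+ 2 + (rs / 2) ^+ 2 +
    rs * (rs / 2) / ((rs / 2) ^+ 2 * (1 + ct ^+ 2)) * (rs / 2) ^+ 2
      * (1 - ct ^+ 2)
  = rs ^+ 2 / (1 + ct ^+ 2) by field; rewrite ct0.
by field; rewrite ?ct0 ?rs0.
Qed.

(** The function [h]: the covector applied to the Killing field [d/dt + (c / rs) d/dphi], where
    [c / rs] is the angular velocity of the horizon. *)
Definition horizon_momentum (q p : 'rV[R]_5) : R :=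
  p 0 0 + c / rs * (p 0 3 * q 0 2 - p 0 2 * q 0 3).

Lemma Sigma2E (z : 'rV[R]_(5 + 5)) : Sigma2 rs c z <->
  cotangent0 (@spacetime R) z /\
  base z 0 1 = rs / 2 /\ horizon_momentum (base z) (fiber z) = 0.
Proof.
rewrite /Sigma2 /setI /= /Psi /p_phi /horizon_momentum.
by split=> -[Nz [zr]]; rewrite zr frame_dragging_horizon.
Qed.

(** * Curves in [Sigma2] with prescribed velocity *)

Section Curve.
Variables z v : 'rV[R]_(5 + 5).
Local Notation q := (base z).
Local Notation p := (fiber z).
Local Notation u := (base v).
Local Notation w := (fiber v).

(** The equations [u1], [qu], [uw], [hw] say that the differentials of [r], [|x|^2], [x . p] and [h]
    at [z] vanish on [v]. *)
Hypothesis Sz : Sigma2 rs c z.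
Hypothesis u1 : u 0 1 = 0.
Hypothesis qu : sdot q u = 0.
Hypothesis uw : sdot u p + sdot q w = 0.
Hypothesis hw :
  w 0 0 + c / rs * (w 0 3 * q 0 2 + p 0 3 * u 0 2
                    - w 0 2 * q 0 3 - p 0 2 * u 0 3) = 0.

(** [X] is the moving sphere point, [L] the affinely moving momentum, [m] its normal component and
    [Y] its projection to the tangent plane at [X]. *)
Let X := sphere_curve q u.
Let L (i : 'I_5) (s : R) : R := p 0 i + s * w 0 i.
Let m (s : R) : R := L 2 s * X 2 s + L 3 s * X 3 s + L 4 s * X 4 s.
Let Y i s : R := L i s - m s * X i s.
Let gamma (s : R) : 'rV[R]_(5 + 5) := row_mx
  (\row_j [:: q 0 0 + s * u 0 0; q 0 1; X 2 s; X 3 s; X 4 s]`_j)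
  (\row_j [:: - (c / rs * (Y 3 s * X 2 s - Y 2 s * X 3 s)); L 1 s;
              Y 2 s; Y 3 s; Y 4 s]`_j).

Let zS : [/\ 0 < q 0 1, sdot q q = 1, sdot q p = 0, p != 0
  & horizon_momentum q p = 0].
Proof. by have /Sigma2E[[/cotangentE[r0 qq qp] p0] [_ hz]] := Sz. Qed.

Let zr : q 0 1 = rs / 2.
Proof. by have /Sigma2E[_ []] := Sz. Qed.

Let dX i : is_derive (0 : R) 1 (X i) (u 0 i).
Proof. exact: is_derive_sphere_curve. Qed.

Let dL i : is_derive (0 : R) 1 (L i) (w 0 i).
Proof. exact: is_derive_affine. Qed.

Let X0 i : X i 0 = q 0 i. Proof. exact: sphere_curve0. Qed.
Let L0 i : L i 0 = p 0 i. Proof. by rewrite /L mul0r addr0. Qed.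

Let m0 : m 0 = 0.
Proof. by have [_ _ + _ _] := zS; rewrite /m !X0 !L0 /sdot; lra. Qed.

Let Y0 i : Y i 0 = p 0 i.
Proof. by rewrite /Y m0 L0 mul0r subr0. Qed.

(** The product rule gives the left side of [uw]. Together with [m0], this shows that the projection
    does not change the velocity of the momentum at [0]. *)
Let dm : is_derive (0 : R) 1 m 0.
Proof.
apply: (is_derive_eq (is_deriveD (is_deriveD (is_deriveM (dL 2) (dX 2))
  (is_deriveM (dL 3) (dX 3))) (is_deriveM (dL 4) (dX 4)))).
by rewrite /GRing.scale /= !L0 !X0 -[RHS]uw /sdot; ring.
Qed.

Let dY i : is_derive (0 : R) 1 (Y i) (w 0 i).
Proof.
apply: (is_derive_eq (is_deriveB (dL i) (is_deriveM dm (dX i)))).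
by rewrite /GRing.scale /= m0 mul0r mulr0 addr0 subr0.
Qed.

Let gamma0 : gamma 0 = z.
Proof.
rewrite /gamma !X0 !Y0 L0 mul0r addr0 -[RHS]row_mx_base_fiber; congr row_mx.
  by rewrite -row_eta5.
have -> : - (c / rs * (p 0 3 * q 0 2 - p 0 2 * q 0 3)) = p 0 0.
  by have [_ _ _ _] := zS; rewrite /horizon_momentum; lra.
by rewrite -row_eta5.
Qed.

Let smX i : smooth_on setT (X i).
Proof. exact: smooth_sphere_curve. Qed.

Let sm_gamma : smooth_on setT gamma.
Proof.
have oT := @openT R.
have smL i : smooth_on setT (L i) by rewrite /L; smooth_tac.
have smY i : smooth_on setT (Y i).
  by rewrite /Y /m; smooth_tac; try exact: smX; exact: smL.
apply: (smooth_row_mx _ _ (fun j s => _) (fun j s => _)) => //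
  -[[|[|[|[|[|//]]]]] ?] /=; try exact: smX; try exact: smY; try exact: smL;
  smooth_tac; try exact: smX; exact: smY.
Qed.

Let d_gamma i : is_derive (0 : R) 1 (fun s => gamma s 0 i) (v 0 i).
Proof.
have db j : is_derive (0 : R) 1 (fun s => base (gamma s) 0 j) (u 0 j).
  under eq_fun do rewrite /gamma base_row_mx row5E.
  have -> : u 0 j = [:: u 0 0; u 0 1; u 0 2; u 0 3; u 0 4]`_j.
    by rewrite {1}[u]row_eta5 row5E.
  case: j => -[|[|[|[|[|//]]]]] ? /=; try exact: dX.
    exact: is_derive_affine.
  by rewrite u1; exact: is_derive_cst.
have df j : is_derive (0 : R) 1 (fun s => fiber (gamma s) 0 j) (w 0 j).
  under eq_fun do rewrite /gamma fiber_row_mx row5E.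
  have -> : w 0 j = [:: w 0 0; w 0 1; w 0 2; w 0 3; w 0 4]`_j.
    by rewrite {1}[w]row_eta5 row5E.
  case: j => -[|[|[|[|[|//]]]]] ? /=; try exact: dL; try exact: dY.
  apply: (is_derive_eq (is_deriveN (is_deriveM (is_derive_cst (c / rs) _ _)
    (is_deriveB (is_deriveM (dY 3) (dX 2)) (is_deriveM (dY 2) (dX 3)))))).
  rewrite /GRing.scale /= !Y0 !X0 mulr0 addr0 /cst.
  by have := hw; lra.
move: (db) (df); rewrite /base /fiber => {}db {}df.
rewrite -[i]fintype.splitK; case: fintype.split => j /=.
  by have := db j; rewrite mxE; under eq_fun do rewrite mxE.
by have := df j; rewrite mxE; under eq_fun do rewrite mxE.
Qed.

(** [gamma] satisfies the four equations at all times; small times serve only to keep the momentum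
    nonzero, an open condition. *)
Lemma tangent_Sigma2 : tangent (Sigma2 rs c) z v.
Proof.
have [r0 qq qp p0 hz] := zS.
apply: (tangent_curve _ _ _ _ gamma) => //.
have : \forall s \near (0 : R), fiber (gamma s) != 0.
  have cg : gamma @ (0 : R) --> z.
    by rewrite -gamma0; exact: (smooth_continuous _ _ _ sm_gamma I).
  apply: (cg [set z | fiber z != 0]); apply: open_nbhs_nbhs; split=> //.
  exact: open_fiber_neq0.
apply: filterS => s gs0; apply/Sigma2E.
have Xs : sdot (base (gamma s)) (base (gamma s)) = 1.
  by rewrite /gamma base_row_mx /sdot !row5E /= -!expr2; exact: sphere_curve_unit.
split; last first.
  by rewrite /horizon_momentum /gamma base_row_mx fiber_row_mx !row5E /= addNr.
split=> //; apply/cotangentE; split=> //.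
  by rewrite /gamma base_row_mx row5E.
move: Xs; rewrite /gamma base_row_mx fiber_row_mx /sdot !row5E /= => Xs.
transitivity (L 2 s * X 2 s + L 3 s * X 3 s + L 4 s * X 4 s
  - m s * (X 2 s * X 2 s + X 3 s * X 3 s + X 4 s * X 4 s)).
  by rewrite /Y; ring.
by rewrite Xs mulr1 subrr.
Qed.

End Curve.

(** * Involutivity *)

Lemma dot5E (x y : 'rV[R]_5) : dot x y =
  x 0 0 * y 0 0 + x 0 1 * y 0 1 + x 0 2 * y 0 2 + x 0 3 * y 0 3 + x 0 4 * y 0 4.
Proof.
rewrite [x]row_eta5 [y]row_eta5 /dot !big_ord_recl big_ord0 addr0 !addrA.
by rewrite !row5E.
Qed.

Lemma involutive_Sigma2 : is_involutive (@spacetime R) (Sigma2 rs c).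
Proof.
move=> z Sz v [vT vS].
have [qu uw] := tangent_cotangent _ _ vT.
have /Sigma2E[[/cotangentE[r0 qq qp] p0] [_ hz]] := Sz.
have u1 : base v 0 1 = 0.
  (* This is [d/dp_r]; its pairing with [v] is [- dr(v)]. *)
  pose w : 'rV[R]_(5 + 5) := row_mx 0 (\row_j [:: 0; 1; 0; 0; 0]`_j).
  have wT : tangent (Sigma2 rs c) z w.
    by apply: tangent_Sigma2 => //;
      rewrite /w ?base_row_mx ?fiber_row_mx ?/sdot ?row5E ?mxE /=; ring.
  have := vS w wT.
  by rewrite /sympl /w base_row_mx fiber_row_mx !dot5E !row5E /= !mxE; lra.
apply: tangent_Sigma2 => //.
pose k := c / rs.
(* The cotangent lift of [d/dt + k d/dphi]: it rotates position and momentum together, and its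
   pairing with [v] is [dh(v)], the remaining condition of [tangent_Sigma2]. *)
pose w : 'rV[R]_(5 + 5) := row_mx
  (\row_j [:: 1; 0; - k * base z 0 3; k * base z 0 2; 0]`_j)
  (\row_j [:: 0; 0; - k * fiber z 0 3; k * fiber z 0 2; 0]`_j).
have wT : tangent (Sigma2 rs c) z w.
  by apply: tangent_Sigma2 => //;
    rewrite /w ?base_row_mx ?fiber_row_mx ?/sdot ?row5E /= -/k; ring.
have := vS w wT.
by rewrite /sympl /w base_row_mx fiber_row_mx !dot5E !row5E /= -/k; lra.
Qed.

(** * Slice charts and the submanifold property *)

Lemma chart_at (a Om : R) (z : 'rV[R]_(5 + 5)) :
  0 < base z 0 1 -> fiber z != 0 ->
  exists U phi, [/\ U z, diffeo_on U phi,
    (forall y, U y -> fiber y != 0 /\ 0 < base y 0 1) &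
    forall y, U y -> [/\ fiber (phi y) 0 1 = base y 0 1 - a,
     fiber (phi y) 0 2 = fiber y 0 0
       + Om * (fiber y 0 3 * base y 0 2 - fiber y 0 2 * base y 0 3),
     fiber (phi y) 0 3 = 0 <-> sdot (base y) (base y) = 1 &
     sdot (base y) (base y) = 1 ->
       (fiber (phi y) 0 4 = 0 <-> sdot (base y) (fiber y) = 0)]].
Proof.
move=> r0 p0.
(* The center of projection is taken in the hemisphere opposite to the point, according to the sign
   of [x3]. *)
have [ep [ep2 epz]] : exists ep : R, ep * ep = 1 /\ 0 < 1 + ep * base z 0 4.
  have [x0|x0] := leP 0 (base z 0 4); first by exists 1; split; lra.
  by exists (-1); split; lra.
pose U0 := [set y : 'rV[R]_(5 + 5) | 1 + ep * base y 0 4 != 0].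
pose V0 := [set y : 'rV[R]_(5 + 5) | fiber y 0 3 + 2 != 0].
have openPre (f : 'rV[R]_(5 + 5) -> R) (A : set R) :
    smooth_on setT f -> open A -> open (f @^-1` A).
  move=> sf oA; rewrite openE => x Ax.
  have cf : f @ x --> f x := smooth_continuous _ _ x sf I.
  exact: (cf A (open_nbhs_nbhs (conj oA Ax))).
have oT := @openT 'rV[R]_(5 + 5).
have oU0 : open U0.
  apply: (openPre (fun y => 1 + ep * base y 0 4) [set x | x != 0]);
    last exact: open_neq.
  by smooth_tac.
have oV0 : open V0.
  apply: (openPre (fun y => fiber y 0 3 + 2) [set x | x != 0]);
    last exact: open_neq.
  by smooth_tac.
(* The open conditions of [cotangent0] are built into [U], so that on [U] only equations remain to
   be matched. *)
pose U := U0 `&` ([set y | fiber y != 0] `&` [set y | 0 < base y 0 1]).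
have oU : open U.
  apply: openI => //; apply: openI; first exact: open_fiber_neq0.
  apply: (openPre (fun y => base y 0 1) [set x | 0 < x]); last exact: open_gt.
  by smooth_tac.
exists U, (chart ep a Om); split.
- by split; [rewrite /U0 /= gt_eqF|split].
- apply: (diffeo_onI _ U0 V0 U _ (chart_inv ep a Om)) => //.
  + exact: smooth_chart.
  + exact: smooth_chart_inv.
  + by move=> y; exact: chartK.
  + by move=> y y0; have [] := chart_invK ep a Om ep2 y y0.
  + exact: subIsetl.
- by move=> y [_].
move=> y [y0 _]; rewrite /U0 /= in y0.
rewrite /chart fiber_row_mx !row5E /=.
set W := stereo ep y 2 ^+ 2 + stereo ep y 3 ^+ 2.
have W0 : 1 + W != 0 := one_add_sqr_neq0 _ _.
have x1E : stereo ep y 2 * (1 + ep * base y 0 4) = base y 0 2 by rewrite mulfVK.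
have x2E : stereo ep y 3 * (1 + ep * base y 0 4) = base y 0 3 by rewrite mulfVK.
have epE : ep ^+ 2 = 1 by rewrite expr2.
have sE : (1 + ep * base y 0 4) * (ep * base y 0 4 * (1 + W) + W - 1) =
    sdot (base y) (base y) - 1.
  rewrite /sdot -x1E -x2E /W; ring: epE.
have sE0 : ep * base y 0 4 * (1 + W) + W - 1 = 0 <-> sdot (base y) (base y) = 1.
  split=> [e|e].
    by apply/eqP; rewrite -subr_eq0 -sE e mulr0.
  by move/eqP: sE; rewrite e subrr mulf_eq0 (negbTE y0) => /eqP.
split=> // /sE0 e.
set Pn := ep * fiber y 0 4 + _.
suff -> : Pn = sdot (base y) (fiber y) by [].
(* On the sphere this identity turns each [w_i] into [x_i]; the last coordinate then differs from
   [x . p] by a multiple of the vanishing constraint coordinate. *)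
have l2 : 2 / (1 + W) = 1 + ep * base y 0 4.
  have -> : 2 = (1 + ep * base y 0 4) * (1 + W) by move: e; lra.
  by rewrite mulfK.
rewrite /Pn mulrAC l2 /sdot -x1E -x2E.
apply/eqP; rewrite -subr_eq0; apply/eqP.
transitivity (- (ep * fiber y 0 4) * (ep * base y 0 4 * (1 + W) + W - 1)).
  by rewrite /W; ring: epE.
by rewrite e mulr0.
Qed.

(** The slices start at index [8 = 5 + 3] for the cotangent bundle and [6 = 5 + 1] for [Sigma2],
    both within the second half of the chart. *)
Lemma fiber_last_eq0 (k : nat) (y : 'rV[R]_(5 + 5)) :
  (forall i : 'I_(5 + 5), (5 + k <= i)%N -> y 0 i = 0) <->
  (forall j : 'I_5, (k <= j)%N -> fiber y 0 j = 0).
Proof.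
split=> y0 i ki; first by rewrite mxE y0 //= leq_add2l.
case: (fintype.splitP i) ki => j ij; rewrite ij.
  by rewrite leqNgt (leq_trans (ltn_ord j)) ?leq_addr.
rewrite leq_add2l => /y0; rewrite mxE; congr (y 0 _ = 0); exact: val_inj.
Qed.

Lemma forall_ge3 (v : 'rV[R]_5) :
  (forall j : 'I_5, (3 <= j)%N -> v 0 j = 0) <-> v 0 3 = 0 /\ v 0 4 = 0.
Proof.
split=> [v0|[v3 v4]]; first by split; exact: v0.
case=> -[|[|[|[|[|//]]]]] i //= _.
  by rewrite -[RHS]v3; congr (v 0 _); exact: val_inj.
by rewrite -[RHS]v4; congr (v 0 _); exact: val_inj.
Qed.

Lemma forall_ge1 (v : 'rV[R]_5) :
  (forall j : 'I_5, (1 <= j)%N -> v 0 j = 0) <->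
  [/\ v 0 1 = 0, v 0 2 = 0, v 0 3 = 0 & v 0 4 = 0].
Proof.
split=> [v0|[v1 v2 v3 v4]]; first by split; exact: v0.
case=> -[|[|[|[|[|//]]]]] i //= _.
- by rewrite -[RHS]v1; congr (v 0 _); exact: val_inj.
- by rewrite -[RHS]v2; congr (v 0 _); exact: val_inj.
- by rewrite -[RHS]v3; congr (v 0 _); exact: val_inj.
- by rewrite -[RHS]v4; congr (v 0 _); exact: val_inj.
Qed.

(** One chart, with [a = rs / 2] and [Om = c / rs], serves both sets: its last two coordinates cut
    out the bundle, and the two before them are [r - rs / 2] and [h]. *)
Lemma flattening_chart (z : 'rV[R]_(5 + 5)) : cotangent0 (@spacetime R) z ->
  exists U phi, [/\ U z, diffeo_on U phi,
    flattens 8 U phi (cotangent0 (@spacetime R)) &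
    flattens (8 - 2) U phi (Sigma2 rs c)].
Proof.
move=> [/cotangentE[r0 _ _] p0].
have [U [phi [Uz dphi Upos Uphi]]] := chart_at (rs / 2) (c / rs) z r0 p0.
have NE y : U y -> cotangent0 (@spacetime R) y <->
    fiber (phi y) 0 3 = 0 /\ fiber (phi y) 0 4 = 0.
  move=> Uy; have [_ _ e3 e4] := Uphi y Uy; have [py ry] := Upos y Uy.
  split=> [[/cotangentE[_ q1 qp] _]|[/e3 q1 /(e4 q1) qp]].
    by split; [exact/e3|exact/(e4 q1)].
  by split=> //; apply/cotangentE.
exists U, phi; split=> // y Uy.
  by apply: (iff_trans (NE _ Uy)); apply: iff_sym;
    apply: (iff_trans (fiber_last_eq0 3 _)); exact: forall_ge3.
apply: (iff_trans (Sigma2E _)); apply: iff_sym.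
apply: (iff_trans (fiber_last_eq0 1 _)); apply: (iff_trans (forall_ge1 _)).
have [e1 e2 _ _] := Uphi y Uy; rewrite e1 e2; split.
  move=> [/eqP h1 h2 h3 h4]; split; first exact/NE.
  by split=> //; apply/eqP; rewrite -subr_eq0.
by move=> [/(NE _ Uy)[h3 h4] [-> h2]]; split=> //; rewrite subrr.
Qed.

Lemma submanifold_of_Sigma2 :
  submanifold_of 8 2 (cotangent0 (@spacetime R)) (Sigma2 rs c).
Proof.
split=> //; last 1 first.
- by move=> z /Sigma2E[/flattening_chart].
- split=> // z /flattening_chart[U [phi [Uz dphi fl _]]].
  by exists U, phi.
- by move=> z [].
Qed.

End Sigma2.

Theorem lemma3p2 (R : realType) (rs c : R) (rs_gt0 : 0 < rs) (c_gt0 : 0 < c) :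
  submanifold_of 8 2 (cotangent0 (@spacetime R)) (Sigma2 rs c) /\
  is_involutive (@spacetime R) (Sigma2 rs c).
Proof.
split; [exact: submanifold_of_Sigma2|exact: involutive_Sigma2].
Qed.
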